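(* Let $H\in\mathcal N_2$ be a normal affine semigroup in $\mathbb N^2$ with extremal rays $\mathbf a_1=(x_1,y_1)$ and $\mathbf a_2=(x_2,y_2)$, labeled so that $\mathbf a_1$ is closer to the $x$-axis, and let $\mathbf b=(u,v)$ be the bottom element of $H$. Then (a) $|H_1^*|=vx_1-uy_1-1$ and $|H_2^*|=uy_2-vx_2-1$; (b) $1\le vx_1-uy_1\le x_1$ and $1\le uy_2-vx_2\le y_2$; (c) if $H_1^*\ne\emptyset$ then $vx_1-uy_1\le x_1-u$; (d) if $H_2^*\ne\emptyset$ then $uy_2-vx_2\le y_2-v$.
   Context: $\mathbb N=\{0,1,2,\dots\}$. $\mathcal N_2$ is the class of normal affine semigroups $H\subseteq\mathbb N^2$ generating $\mathbb Z^2$ as a group: $H$ is a finitely generated submonoid of $\mathbb N^2$ with $H=C\cap\mathbb Z^2$, where $C\subseteq\mathbb R^2$ is the (two-dimensional) cone generated by $H$. The extremal rays of $H$ are the primitive lattice vectors $\mathbf a_1,\mathbf a_2\in H$ lying on the two extremal rays of $C$. They are labeled $\mathbf a_1=(x_1,y_1)$, $\mathbf a_2=(x_2,y_2)$ so that $x_1>0$ and either $x_2=0$ or $y_1/x_1<y_2/x_2$. Put $\omega_H=\mathbb Z^2\cap\operatorname{relint}C$. The bottom element $\mathbf b$ of $H$ is the unique element of $\omega_H$ that is minimal (least) in $\omega_H$ for the componentwise order on $\mathbb N^2$ (it always exists). For $i=1,2$, $H_i^*=\mathbb Z^2\cap\{r_1\mathbf a_i+r_2\mathbf b:0<r_1,r_2<1\}$.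 *)

(* Defs.v *)
From mathcomp Require Import all_boot all_order all_algebra finmap.
From mathcomp Require Import all_classical all_reals all_analysis.
Set Implicit Arguments.
Unset Strict Implicit.
Unset Printing Implicit Defensive.
Import Order.TTheory GRing.Theory Num.Theory.
Import numFieldNormedType.Exports.
Local Open Scope classical_set_scope.
Local Open Scope ring_scope.

Definition submonoid (V : nmodType) (M : set V) : Prop :=
  M 0 /\ forall x y, M x -> M y -> M (x + y).

Definition subgroup (V : zmodType) (G : set V) : Prop :=
  submonoid G /\ forall x, G x -> G (- x).

Definition fg_submonoid (V : nmodType) (M : set V) : Prop :=
  exists F : set V, finite_set F /\ M = smallest (@submonoid V) F.

Definition generates (V : zmodType) (S : set V) : Prop :=
  smallest (@subgroup V) S = setT.

Definition cone (R : realType) (V : lmodType R) (S : set V) : set V :=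
  [set x | exists (n : nat) (s : 'I_n -> V) (r : 'I_n -> R),
     (forall i, S (s i) /\ 0 <= r i) /\ x = \sum_(i < n) r i *: s i].

Definition affine_hull (R : realType) (V : lmodType R) (S : set V) : set V :=
  [set x | exists (n : nat) (s : 'I_n -> V) (r : 'I_n -> R),
     [/\ forall i, S (s i), \sum_(i < n) r i = 1
       & x = \sum_(i < n) r i *: s i]].

Definition relint (R : realType) (V : normedModType R) (A : set V) : set V :=
  [set x | A x /\ \forall y \near x, affine_hull A y -> A y].

Definition ray (R : realType) (V : lmodType R) (v : V) : set V :=
  [set r *: v | r in [set r : R | 0 <= r]].

Definition extremal_ray (R : realType) (V : lmodType R) (C rho : set V) : Prop :=
  [/\ exists2 v : V, v != 0 & rho = ray v,
      rho `<=` C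
    & forall x y, C x -> C y -> rho (x + y) -> rho x /\ rho y].

Definition emb (R : realType) (p : int * int) : R * R := (p.1%:~R, p.2%:~R).

Definition semigroup_cone (R : realType) (H : set (int * int)) : set (R * R) :=
  cone (emb R @` H).
Arguments semigroup_cone : clear implicits.

(* Semigroups in N^2 are represented as subsets of Z^2 contained in the
   nonnegative quadrant, so that H, omega_H and H_i^* live in the same type. *)
Record in_N2 (R : realType) (H : set (int * int)) : Prop := InN2 {
  N2_nonneg : forall p, H p -> 0 <= p.1 /\ 0 <= p.2;
  N2_fg : fg_submonoid H;
  N2_generates : generates H;
  N2_normal : H = emb R @^-1` semigroup_cone R H
}.

Definition extremal_vector (R : realType) (H : set (int * int))
    (a : int * int) : Prop :=
  [/\ H a, coprimez a.1 a.2
    & extremal_ray (semigroup_cone R H) (ray (emb R a))].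

Definition omega (R : realType) (H : set (int * int)) : set (int * int) :=
  emb R @^-1` relint (semigroup_cone R H).

Definition bottom_element (R : realType) (H : set (int * int)) (b : int * int) : Prop :=
  omega R H b /\ forall w, omega R H w -> b.1 <= w.1 /\ b.2 <= w.2.

(* H_i^* is [Hstar R a_i b]. *)
Definition Hstar (R : realType) (a b : int * int) : set (int * int) :=
  emb R @^-1` [set x | exists r1 r2 : R,
    [/\ 0 < r1 < 1, 0 < r2 < 1 & x = r1 *: emb R a + r2 *: emb R b]].

(* Main.v *)
(** The cone is cut out by [0 <= det (a1, z)] and [0 <= det (z, a2)]: an element
    of [H] violating one of these would write a multiple of an extremal vector as
    a sum of cone elements off its ray.  So [omega_H] is given by the strict
    inequalities.  Minimality makes [b] primitive, and then [z |-> det (a1, z)] is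
    a bijection from [H_1^*] onto the integers strictly between [0] and
    [det (a1, b)], which is (a).  For (b), [b - (0, 1)] and [b - (1, 0)] are not in
    [omega_H].  For (c), both [z] and its reflection [a1 + b - z] lie in [omega_H]
    for [z] in [H_1^*], so [b <= z <= a1]; the first coordinate then maps [H_1^*]
    injectively into the integers strictly between [u] and [x1]. Part (d) is
    symmetric, using second coordinates. *)
Require Import Defs.
From mathcomp Require Import all_boot all_order all_algebra finmap.
From mathcomp Require Import all_classical all_reals all_analysis.
From mathcomp Require Import ring lra zify.
Set Implicit Arguments.
Unset Strict Implicit.
Unset Printing Implicit Defensive.
Import Order.TTheory GRing.Theory Num.Theory.
Import numFieldNormedType.Exports.
Local Open Scope classical_set_scope.
Local Open Scope ring_scope.

(** * Determinants and lattice points of open parallelograms *)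

Definition det2 (K : pzRingType) (p q : K * K) : K := p.1 * q.2 - p.2 * q.1.

(* By Cramer's rule, the lattice points of the open parallelogram spanned by [a]
   and [b] when [0 < det2 a b]; empty otherwise. *)
Definition open_par (a b : int * int) : set (int * int) :=
  [set z | 0 < det2 a z < det2 a b /\ 0 < det2 z b < det2 a b].

(** Bezout coefficients of [b] read the multiplier [m] off [z]. *)
Lemma primitive_colinear (b z : int * int) :
  coprimez b.1 b.2 -> det2 z b = 0 -> exists m : int, z = (m * b.1, m * b.2).
Proof.
case: b z => [b1 b2] [z1 z2] /coprimezP[[s t] /= st1]; rewrite /det2 /= => d0.
exists (s * z1 + t * z2); congr pair.
- rewrite -[LHS]mulr1 -st1.
  transitivity ((s * z1 + t * z2) * b1 + t * (z1 * b2 - z2 * b1)); first by ring.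
  by rewrite d0; ring.
- rewrite -[LHS]mulr1 -st1.
  transitivity ((s * z1 + t * z2) * b2 - s * (z1 * b2 - z2 * b1)); first by ring.
  by rewrite d0; ring.
Qed.

Lemma open_par_bij (a b : int * int) :
  coprimez a.1 a.2 -> coprimez b.1 b.2 -> 0 < det2 a b ->
  set_bij (open_par a b) `I_(`|det2 a b|.-1) (fun z => `|det2 a z|.-1).
Proof.
move=> ca cb; set D := det2 a b => D0; split.
- by move=> z [/=]; rewrite -/D; lia.
(* Injectivity: [z - w] is [m] times [a], and [m * D] is a difference of two integers strictly
   between 0 and [D]. *)
- move=> z w; rewrite !inE => -[za zb] [wa wb] zw.
  have azw : det2 a z = det2 a w by move: za wa zw; rewrite -/D; lia.
  pose d := (z.1 - w.1, z.2 - w.2).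
  have /(primitive_colinear ca)[m dm] : det2 d a = 0.
    have -> : det2 d a = det2 a w - det2 a z by rewrite /det2 /=; ring.
    by rewrite azw subrr.
  have mD : det2 z b - det2 w b = m * D.
    have -> : det2 z b - det2 w b = det2 d b by rewrite /det2 /=; ring.
    by rewrite dm /D /det2 /=; ring.
  have m0 : m = 0 by move: zb wb mD; rewrite -/D; nia.
  move: dm; rewrite m0 !mul0r => -[/subr0_eq zw1 /subr0_eq zw2].
  by rewrite [z]surjective_pairing zw1 zw2 -surjective_pairing.
- move=> k /= kD.
  (* Surjectivity: Bezout gives [z0] with [det2 a z0 = k + 1]; subtracting [q] times [a] keeps this
     value and reduces [det2 z0 b] modulo [D]. *)
  have /coprimezP[[s t] /= st1] := ca.
  pose z0 : int * int := (- t * k.+1%:Z, s * k.+1%:Z).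
  pose q := (det2 z0 b %/ D)%Z.
  pose z := (z0.1 - q * a.1, z0.2 - q * a.2).
  have az : det2 a z = k.+1%:Z.
    by rewrite -[RHS]mul1r -st1 /det2 /=; ring.
  have zb : det2 z b = (det2 z0 b %% D)%Z.
    by rewrite /modz -/q /D /det2 /=; ring.
  have zb0 : 0 <= det2 z b by rewrite zb modz_ge0// gt_eqF.
  have zbD : det2 z b < D by rewrite zb ltz_pmod.
  exists z; last by rewrite az.
  split; first by rewrite -/D az; lia.
  rewrite -/D zbD lt_neqAle zb0 !andbT eq_sym.
  (* A zero residue would make [z] a multiple of [b], so [D] would divide [k + 1 < D]. *)
  apply/eqP => /(primitive_colinear cb)[m zm].
  have kmD : k.+1%:Z = m * D by rewrite -az zm /D /det2 /=; ring.
  have kD' : 0 < k.+1%:Z < D by move: kD; rewrite /D; lia.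
  have m0 : 0 < m by rewrite -(pmulr_lgt0 _ D0) -kmD; lia.
  nia.
Qed.

Lemma card_open_par (a b : int * int) :
  coprimez a.1 a.2 -> coprimez b.1 b.2 -> 0 < det2 a b ->
  (open_par a b #= `I_(`|det2 a b|.-1))%card.
Proof.
by move=> ca cb D0; apply/card_set_bijP; eexists; exact: open_par_bij.
Qed.

Lemma card_le_set_inj (T U : Type) (A : set T) (B : set U) (f : T -> U) :
  set_fun A B f -> set_inj A f -> (A #<= B)%card.
Proof.
move=> fAB injf; rewrite -(card_le_eql (inj_card_eq injf)).
by apply: subset_card_le => _ [x Ax <-]; exact: fAB.
Qed.

(** * The cone as the sector between the extremal vectors *)

Lemma cone_comb (R : realType) (V : lmodType R) (S : set V) (s t : V) (r q : R) :
  S s -> S t -> 0 <= r -> 0 <= q -> cone S (r *: s + q *: t).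
Proof.
move=> Ss St r0 q0.
exists 2%N, (fun i => if i == ord0 then s else t),
  (fun i => if i == ord0 then r else q); split; last first.
  by rewrite !big_ord_recl big_ord0 addr0.
by move=> i; case: ifP.
Qed.

Lemma emb_det2 (R : realType) (p q : int * int) :
  det2 (emb R p) (emb R q) = (det2 p q)%:~R.
Proof. by rewrite /det2 /= intrB !intrM. Qed.

(* All of [H] lies on one side of the line through an extremal vector. *)
Lemma extremal_det2 (R : realType) (H : set (int * int)) (a b h : int * int) :
  (forall p, H p -> 0 <= p.1 /\ 0 <= p.2) ->
  extremal_vector R H a -> H b -> H h -> 0 <= det2 a b * det2 a h.
Proof.
move=> H0 [Ha _ [_ _ exta]] Hb Hh; rewrite leNgt; apply/negP => abh.
have [[[a10 a20] [b10 b20]] [h10 h20]] := (H0 _ Ha, H0 _ Hb, H0 _ Hh).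
(* Cramer's relation [det2 h b * a = det2 a b * h - det2 a h * b], multiplied by [det2 a b] so that
   [h] and [b] get positive coefficients. *)
pose k : R := (det2 a b ^+ 2)%:~R; pose l : R := (- (det2 a b * det2 a h))%:~R.
pose m := det2 a b * det2 h b.
have k0 : 0 < k.
  rewrite ltr0z exprn_even_gt0//=; apply: contraTneq abh => ->.
  by rewrite mul0r ltxx.
have l0 : 0 < l by rewrite ltr0z oppr_gt0.
have E1 : m * a.1 = det2 a b ^+ 2 * h.1 - (det2 a b * det2 a h) * b.1.
  by rewrite /m /det2; ring.
have E2 : m * a.2 = det2 a b ^+ 2 * h.2 - (det2 a b * det2 a h) * b.2.
  by rewrite /m /det2; ring.
have rhs_ge0 c d : 0 <= c -> 0 <= d ->
    0 <= det2 a b ^+ 2 * c - (det2 a b * det2 a h) * d.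
  move=> c0 d0; rewrite subr_ge0; apply: (@le_trans _ _ 0).
    by apply: mulr_le0_ge0 => //; exact: ltW.
  by rewrite mulr_ge0 ?sqr_ge0.
(* This puts the sum on the ray of [a] and not merely on its line. *)
have m0 : 0 <= m.
  have [a0|a0] : 0 < a.1 \/ 0 < a.2.
    rewrite !lt_neqAle a10 a20 !andbT; apply/orP; rewrite -negb_and.
    apply: contraTN abh => /andP[/eqP a1E /eqP a2E].
    by rewrite /det2 -a1E -a2E !mul0r ltxx.
  - by rewrite -(pmulr_lge0 _ a0) E1 rhs_ge0.
  - by rewrite -(pmulr_lge0 _ a0) E2 rhs_ge0.
have inC p (r : R) : 0 <= r -> H p -> semigroup_cone R H (r *: emb R p).
  move=> r0 Hp; rewrite -[_ *: _]addr0 -[0](scale0r (emb R p)).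
  by apply: cone_comb => //; exists p.
have [|[r _ rE] _] := exta (k *: emb R h) (l *: emb R b)
    (inC _ _ (ltW k0) Hh) (inC _ _ (ltW l0) Hb).
  exists m%:~R; first by rewrite /= ler0z.
  by rewrite /emb; congr pair;
    rewrite /k /l /= /GRing.scale /= -!intrM -intrD mulNr ?E1 ?E2.
have : k * det2 (emb R a) (emb R h) = 0.
  have -> : k * det2 (emb R a) (emb R h) = det2 (emb R a) (k *: emb R h).
    by rewrite /det2 /= /GRing.scale /=; ring.
  by rewrite -rE /det2 /= /GRing.scale /=; ring.
move/eqP; rewrite mulf_eq0 gt_eqF//= emb_det2 intr_eq0 => /eqP ah0.
by move: abh; rewrite ah0 mulr0 ltxx.
Qed.

(** The factor [e] is taken to be 1 or -1, to serve both sides of the sector. *)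
Lemma cone_det2_ge0 (R : realType) (S : set (R * R)) (a : R * R) (e : R) :
  (forall s, S s -> 0 <= e * det2 a s) ->
  forall x, cone S x -> 0 <= e * det2 a x.
Proof.
move=> Sa _ [n [s [r [sr ->]]]].
apply: (big_ind (fun x => 0 <= e * det2 a x)).
- by rewrite /det2 /= !mulr0 subrr mulr0.
- move=> x y ax ay; have -> : e * det2 a (x + y) = e * det2 a x + e * det2 a y.
    by rewrite /det2 /=; ring.
  exact: addr_ge0.
- move=> i _; have [Si ri] := sr i.
  have -> : e * det2 a (r i *: s i) = r i * (e * det2 a (s i)).
    by rewrite /det2 /= /GRing.scale /=; ring.
  by rewrite mulr_ge0// Sa.
Qed.

(** Each extremal vector yields one inequality, the other one fixing its sign. Conversely, Cramer's
    rule gives nonnegative coefficients on [a1] and [a2]. *)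
Lemma semigroup_coneE (R : realType) (H : set (int * int)) (a1 a2 : int * int) :
  (forall p, H p -> 0 <= p.1 /\ 0 <= p.2) ->
  extremal_vector R H a1 -> extremal_vector R H a2 -> 0 < det2 a1 a2 ->
  semigroup_cone R H =
    [set z | 0 <= det2 (emb R a1) z /\ 0 <= det2 z (emb R a2)].
Proof.
move=> H0 ea1 ea2 a12.
have [[Ha1 _ _] [Ha2 _ _]] := (ea1, ea2).
have det2C (p q : R * R) : det2 p q = -1 * det2 q p by rewrite /det2; ring.
apply/seteqP; split => [x Cx|x [/= x1 x2]].
  split.
    rewrite -[det2 _ _]mul1r; apply: cone_det2_ge0 Cx => _ [h Hh <-].
    rewrite mul1r emb_det2 ler0z -(pmulr_rge0 _ a12).
    exact: extremal_det2 H0 ea1 Ha2 Hh.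
  rewrite det2C; apply: cone_det2_ge0 Cx => _ [h Hh <-].
  rewrite -det2C emb_det2 ler0z -(pmulr_rge0 _ a12).
  have -> : det2 a1 a2 * det2 h a2 = det2 a2 a1 * det2 a2 h by rewrite /det2; ring.
  exact: extremal_det2 H0 ea2 Ha1 Hh.
have D0 : 0 < det2 (emb R a1) (emb R a2) by rewrite emb_det2 ltr0z.
set D := det2 (emb R a1) (emb R a2) in D0.
have -> : x = (det2 x (emb R a2) / D) *: emb R a1 +
    (det2 (emb R a1) x / D) *: emb R a2.
  move: D0; rewrite /D /det2 [LHS]surjective_pairing /= => /lt0r_neq0 D0.
  by congr pair; rewrite /= /GRing.scale /=; field.
by apply: cone_comb; [exists a1|exists a2|exact: divr_ge0 (ltW _)|
  exact: divr_ge0 (ltW _)].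
Qed.

(** * The relative interior of a sector *)

Lemma cvg_det2 (R : realType) (a z : R * R) : det2 a y @[y --> z] --> det2 a z.
Proof.
apply: cvgB; apply: cvgMl_tmp; [exact: cvg_snd|exact: cvg_fst].
Qed.

Lemma relint_sector (R : realType) (a b : R * R) : 0 < det2 a b ->
  relint [set z | 0 <= det2 a z /\ 0 <= det2 z b] =
  [set z | 0 < det2 a z /\ 0 < det2 z b].
Proof.
set K := [set z | _]; move=> D0.
have det2C (p q : R * R) : det2 p q = - det2 q p by rewrite /det2; ring.
(* The points [a], [b] and 0 affinely span the plane, so the relative interior is the interior. *)
have affK y : affine_hull K y.
  pose r1 := det2 y b / det2 a b; pose r2 := det2 a y / det2 a b.
  exists 3%N, (tnth [tuple a; b; 0]), (tnth [tuple r1; r2; 1 - r1 - r2]).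
  have [aa bb] : det2 a a = 0 /\ det2 b b = 0 by split; rewrite /det2; ring.
  split.
  - move=> i; rewrite /K /=; case: i => -[|[|[|//]]] ? /=; rewrite /tnth /=.
    + by rewrite aa; split=> //; exact: ltW.
    + by rewrite bb; split=> //; exact: ltW.
    + by rewrite /det2 /= !(mulr0, mul0r) subrr lexx.
  - by rewrite !big_ord_recl big_ord0 /tnth /=; ring.
  - rewrite !big_ord_recl big_ord0 /tnth /= [LHS]surjective_pairing.
    move: D0; rewrite /r1 /r2 /det2 => /lt0r_neq0 D0.
    by congr pair; rewrite /= /GRing.scale /=; field.
apply/seteqP; split => z.
- move=> [_ Kz].
  (* Moving by [- t *: (a + b)] lowers both determinants by [t * det2 a b]; for small [t > 0] the
     point stays in [K]. *)
  have cz : (z - t *: (a + b)) @[t --> 0^'+] --> z.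
    rewrite -[X in _ --> X]subr0 -(scale0r (a + b)).
    apply: cvgB; first exact: cvg_cst.
    by apply: cvgZr_tmp; apply: cvg_at_right_filter; exact: cvg_id.
  have /filter_ex[t [t0 Kt]] : \forall t \near (0 : R)^'+, 0 < t /\ K (z - t *: (a + b)).
    apply: filterI; first exact: nbhs_right_gt.
    exact: (cz _ (filterS (fun y Ky => Ky (affK y)) Kz)).
  have ab (s : R) : det2 a (z - s *: (a + b)) = det2 a z - s * det2 a b /\
      det2 (z - s *: (a + b)) b = det2 z b - s * det2 a b.
    by split; rewrite /det2 /= /GRing.scale /=; ring.
  have tD : 0 < t * det2 a b by exact: mulr_gt0.
  move: Kt; rewrite /K /=; case: (ab t) => -> ->.
  rewrite !subr_ge0 => -[? ?].
  by split; exact: lt_le_trans tD _.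
- move=> [az zb]; split; first by split; exact: ltW.
  near=> y; move=> _; split; apply: ltW.
    by near: y; exact: (cvgr_gt _ (@cvg_det2 _ a z)).
  rewrite det2C oppr_gt0; near: y; apply: (cvgr_lt _ (@cvg_det2 _ b z)).
  by rewrite -oppr_gt0 -det2C.
Unshelve. all: by end_near.
Qed.

(** * Parallelograms: identification, symmetry and counting *)

Lemma HstarC (R : realType) (a b : int * int) : Hstar R a b = Hstar R b a.
Proof.
by apply/seteqP; split=> z [r [q [r01 q01 zE]]]; exists q, r; rewrite addrC.
Qed.

Lemma Hstar_open_par (R : realType) (a b : int * int) :
  0 < det2 a b -> Hstar R a b = open_par a b.
Proof.
move=> ab0; have D0 : 0 < det2 (emb R a) (emb R b) by rewrite emb_det2 ltr0z.
apply/seteqP; split=> z.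
  move=> [r [q [/andP[r0 r1] /andP[q0 q1] zE]]].
  have aE : det2 (emb R a) (emb R z) = q * det2 (emb R a) (emb R b).
    by rewrite zE /det2 /= /GRing.scale /=; ring.
  have bE : det2 (emb R z) (emb R b) = r * det2 (emb R a) (emb R b).
    by rewrite zE /det2 /= /GRing.scale /=; ring.
  split; apply/andP; split; rewrite -?(ltr0z R) -?(ltr_int R) -!emb_det2.
  - by rewrite aE mulr_gt0.
  - by rewrite aE gtr_pMl.
  - by rewrite bE mulr_gt0.
  - by rewrite bE gtr_pMl.
move=> [].
rewrite -2!(ltr0z R) -2!(ltr_int R) -!emb_det2 => /andP[a0 aD] /andP[b0 bD].
exists (det2 (emb R z) (emb R b) / det2 (emb R a) (emb R b)).
exists (det2 (emb R a) (emb R z) / det2 (emb R a) (emb R b)).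
split; rewrite ?divr_gt0 ?ltr_pdivrMr ?mul1r//.
move: D0; rewrite /det2 [LHS]surjective_pairing /= => /lt0r_neq0 D0.
by congr pair; rewrite /= /GRing.scale /=; field.
Qed.

(** Central symmetry turns the lower bound [b] on the points into the upper bound [a]. *)
Lemma open_par_reflect (a b z : int * int) :
  open_par a b z -> open_par a b (a.1 + b.1 - z.1, a.2 + b.2 - z.2).
Proof.
rewrite /open_par /=; set w := (_, _) => -[za zb].
have -> : det2 a w = det2 a b - det2 a z by rewrite /w /det2 /=; ring.
have -> : det2 w b = det2 a b - det2 z b by rewrite /w /det2 /=; ring.
by lia.
Qed.

Lemma card_fset_open_par (a b : int * int) :
  coprimez a.1 a.2 -> coprimez b.1 b.2 -> 0 < det2 a b ->
  finite_set (open_par a b) /\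
  (#|` fset_set (open_par a b)|%fset)%:Z = det2 a b - 1.
Proof.
move=> ca cb D0; have cE := card_open_par ca cb D0.
split; first by exists `|det2 a b|.-1.
by rewrite (card_fset_set cE); lia.
Qed.

(** The [det2 a b - 1] points inject into the integers strictly between [l] and [m]; nonemptiness
    gives [l < m], so there are [m - l - 1] of these. *)
Lemma open_par_card_le (a b : int * int) (f : int * int -> int) (l m : int) :
  coprimez a.1 a.2 -> coprimez b.1 b.2 -> 0 < det2 a b ->
  set_inj (open_par a b) f -> (forall z, open_par a b z -> l < f z < m) ->
  open_par a b !=set0 -> det2 a b <= m - l.
Proof.
move=> ca cb D0 injf flm [z0 /flm z0lm].
have : (open_par a b #<= `I_(`|m - l|.-1))%card.
  apply: (@card_le_set_inj _ _ _ _ (fun z => `|f z - l|.-1)).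
    by move=> z /flm /=; lia.
  move=> z w zP wP zw; apply: injf => //.
  by move: zP wP zw; rewrite !inE => /flm ? /flm ?; lia.
by rewrite (card_le_eql (card_open_par ca cb D0)) card_le_II; lia.
Qed.


Theorem lemma5p16 (R : realType) (H : set (int * int))
    (x1 y1 x2 y2 u v : int)
    (hH : in_N2 R H)
    (ha1 : extremal_vector R H (x1, y1))
    (ha2 : extremal_vector R H (x2, y2))
    (hlabel : 0 < x1 /\ (x2 = 0 \/ y1%:Q / x1%:Q < y2%:Q / x2%:Q))
    (hb : bottom_element R H (u, v)) :
  let H1 := Hstar R (x1, y1) (u, v) in
  let H2 := Hstar R (x2, y2) (u, v) in
  [/\ (* (a) *)
      [/\ finite_set H1, finite_set H2,
          (#|` fset_set H1|%fset)%:Z = v * x1 - u * y1 - 1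
        & (#|` fset_set H2|%fset)%:Z = u * y2 - v * x2 - 1],
      (* (b) *)
      1 <= v * x1 - u * y1 <= x1 /\ 1 <= u * y2 - v * x2 <= y2,
      (* (c) *)
      H1 !=set0 -> v * x1 - u * y1 <= x1 - u
    & (* (d) *)
      H2 !=set0 -> u * y2 - v * x2 <= y2 - v].
Proof.
move=> H1 H2; have [H0 _ _ Hnormal] := hH.
have [Ha1 c1 _] := ha1; have [Ha2 c2 _] := ha2.
have [/= x10 y10] := H0 _ Ha1; have [/= x20 y20] := H0 _ Ha2.
(* Clear denominators in the slopes; in the vertical case, primitivity excludes [y2 = 0]. *)
have D12 : 0 < det2 (x1, y1) (x2, y2).
  case: hlabel => x1_gt0; rewrite /det2 /= subr_gt0; have [x2E|x2N0] := eqVneq x2 0.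
    move=> _; rewrite x2E mulr0 mulr_gt0// lt_neqAle y20 andbT eq_sym.
    by apply: contraTneq c2 => ->; rewrite x2E.
  case=> [x2E|]; first by rewrite x2E eqxx in x2N0.
  have x2_gt0 : 0 < x2 by rewrite lt_neqAle eq_sym x2N0.
  rewrite ltr_pdivrMr ?ltr0z// mulrAC ltr_pdivlMr ?ltr0z//.
  by rewrite -!intrM ltr_int mulrC [X in _ < X]mulrC; lia.
have omegaE w : omega R H w <-> 0 < det2 (x1, y1) w /\ 0 < det2 w (x2, y2).
  rewrite /omega /preimage (semigroup_coneE H0 ha1 ha2 D12).
  by rewrite relint_sector ?emb_det2 ?ltr0z//= !emb_det2 !ltr0z.
have omega0 w : omega R H w -> 0 <= w.1 /\ 0 <= w.2.
  by case=> Cw _; apply: H0; rewrite Hnormal.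
have [ob minb] := hb.
have [/= u0 v0] := omega0 _ ob.
have [D1 D2] := (omegaE _).1 ob.
have D1E : det2 (x1, y1) (u, v) = v * x1 - u * y1 by rewrite /det2 /=; ring.
have D2E : det2 (u, v) (x2, y2) = u * y2 - v * x2 by [].
(* Dividing [b] by its gcd stays in [omega], so by minimality a gcd above 1 would force [b = 0]. *)
have cb : coprimez (u, v).1 (u, v).2.
  rewrite /coprimez /=; set g := gcdz u v.
  have /dvdzP[p uE] : (g %| u)%Z := dvdz_gcdl u v.
  have /dvdzP[q vE] : (g %| v)%Z := dvdz_gcdr u v.
  have g0 : 0 <= g by [].
  have D1g : det2 (x1, y1) (u, v) = g * det2 (x1, y1) (p, q).
    by rewrite {1}uE {1}vE /det2 /=; ring.
  have D2g : det2 (u, v) (x2, y2) = g * det2 (p, q) (x2, y2).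
    by rewrite {1}uE {1}vE /det2 /=; ring.
  have g_gt0 : 0 < g.
    rewrite lt_neqAle g0 andbT; apply: contraTneq D1 => g0E.
    by rewrite D1g -g0E mul0r.
  have opq : omega R H (p, q).
    apply/omegaE; rewrite -(pmulr_rgt0 _ g_gt0) -D1g.
    by rewrite -(pmulr_rgt0 (det2 (p, q) _) g_gt0) -D2g.
  have [/= up vq] := minb _ opq; have [/= p0 q0] := omega0 _ opq.
  apply/eqP/le_anti; rewrite -[1 <= g]/(0 < g) g_gt0 andbT leNgt.
  apply/negP => g_gt1.
  have pE : p = 0 by nia.
  have qE : q = 0 by nia.
  by move: D1; rewrite D1g pE qE /det2 /= !mulr0.
have H1E : H1 = open_par (x1, y1) (u, v) by rewrite /H1 Hstar_open_par.
(* The swap makes the determinant of the generators positive. *)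
have H2E : H2 = open_par (u, v) (x2, y2) by rewrite /H2 HstarC Hstar_open_par.
have [fin1 card1] := card_fset_open_par c1 cb D1.
have [fin2 card2] := card_fset_open_par cb c2 D2.
(* Passing to [(u, v - 1)] subtracts [x1] from the first determinant and adds [x2 >= 0] to the
   second. *)
have D1x1 : v * x1 - u * y1 <= x1.
  rewrite leNgt; apply/negP => ltx1.
  have /minb[_ /=] : omega R H (u, v - 1); last lia.
  by apply/omegaE; move: D2; rewrite /det2 /=; split; lia.
have D2y2 : u * y2 - v * x2 <= y2.
  rewrite leNgt; apply/negP => lty2.
  have /minb[/= + _] : omega R H (u - 1, v); last lia.
  by apply/omegaE; move: D1; rewrite /det2 /=; split; lia.
have bnd1 z : open_par (x1, y1) (u, v) z ->
    [/\ u <= z.1, v <= z.2, z.1 <= x1 & z.2 <= y1].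
  have minz w : open_par (x1, y1) (u, v) w -> u <= w.1 /\ v <= w.2.
    move=> [/andP[w1 _] /andP[wb _]]; apply: minb; apply/omegaE; split=> //.
    (* The Plücker relation makes the remaining determinant positive. *)
    rewrite -(pmulr_rgt0 _ D1).
    have -> : det2 (x1, y1) (u, v) * det2 w (x2, y2) =
      det2 w (u, v) * det2 (x1, y1) (x2, y2) + det2 (x1, y1) w * det2 (u, v) (x2, y2).
      by rewrite /det2 /=; ring.
    by rewrite addr_gt0// mulr_gt0.
  by move=> Pz; have := minz _ Pz; have /= := minz _ (open_par_reflect Pz); split; lia.
have bnd2 z : open_par (u, v) (x2, y2) z ->
    [/\ u <= z.1, v <= z.2, z.1 <= x2 & z.2 <= y2].
  have minz w : open_par (u, v) (x2, y2) w -> u <= w.1 /\ v <= w.2.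
    move=> [/andP[wb _] /andP[w2 _]]; apply: minb; apply/omegaE; split=> //.
    rewrite -(pmulr_rgt0 _ D2).
    have -> : det2 (u, v) (x2, y2) * det2 (x1, y1) w =
      det2 (u, v) w * det2 (x1, y1) (x2, y2) + det2 w (x2, y2) * det2 (x1, y1) (u, v).
      by rewrite /det2 /=; ring.
    by rewrite addr_gt0// mulr_gt0.
  by move=> Pz; have := minz _ Pz; have /= := minz _ (open_par_reflect Pz); split; lia.
rewrite H1E H2E -D1E -D2E; split.
- by split.
- by rewrite -!gtz0_ge1 D1 D2 D1E D2E.
- apply: (@open_par_card_le _ _ fst) => //.
    (* With equal first coordinates, the values of [det2 (x1, y1)] differ by a multiple of [x1], yet
       lie strictly between 0 and a number at most [x1]. *)
    move=> [z1 z2] [w1 w2]; rewrite !inE => -[+ _] [+ _] /= zw.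
    rewrite zw D1E /det2 /= => Pz Pw.
    by congr pair; nia.
  move=> [z1 z2] Pz; have [/= ? ? ? ?] := bnd1 _ Pz.
  (* Strictness: [z1 = u] with [v <= z2] makes the determinant too large, [z1 = x1] with [z2 <= y1]
     makes it nonpositive. *)
  move: Pz; rewrite /open_par /= D1E /det2 /=.
  by nia.
- apply: (@open_par_card_le _ _ snd) => //.
    move=> [z1 z2] [w1 w2]; rewrite !inE => -[_ +] [_ +] /= zw.
    rewrite zw D2E /det2 /= => Pz Pw.
    by congr pair; nia.
  move=> [z1 z2] Pz; have [/= ? ? ? ?] := bnd2 _ Pz.
  move: Pz; rewrite /open_par /= D2E /det2 /=.
  by nia.
Qed.
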